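(* Let $A \in \mathbb{C}^{m \times n}$ and let $r$ be an integer with $0 < r < \min(m,n)$ (the target rank). Let $\varepsilon, \delta \in (0,1)$ and let $d = r+p$ with an integer $p \geq 0$. If $R \in \mathbb{R}^{n\times d}$ is a random $\left(n, d, \frac{\delta}{2\max(5^{2r}, n)}, \frac{\varepsilon}{12}\right)$-JL sketching operator, then with probability at least $1-\delta$: $$\|(I - P_Y)A\| \leq \left(\sqrt{1+ \frac{n(1+\varepsilon)}{1-\varepsilon}}\right)\sigma_{r+1}(A),$$ where $Y = AR$ and $P_Y$ is the orthogonal projector onto the column space of $Y$.
   Context: $\|\cdot\|$ denotes the Euclidean norm of vectors and the spectral (two-)norm of matrices; $\sigma_j(A)$ is the $j$th largest singular value of $A$. The projector is $P_Y = YY^\dagger$ (with $\dagger$ the Moore--Penrose pseudoinverse), equivalently $P_Y = QQ^*=QQ^\dagger$ where $Y = Q\Omega$ is a QR factorization whose factor $Q$ has orthonormal columns spanning the range of $Y$. JL sketching operator: a random real matrix $S$ of size $d \times n$ is an $(n,d,\delta,\varepsilon)$-JL sketching operator if for every fixed vector $x \in \mathbb{R}^n$, $\Pr\left[\left|\|Sx\|^2-\|x\|^2\right| > \varepsilon \|x\|^2\right] < \delta$. Since here the operator is applied on the right, the transposed convention is used: $R \in \mathbb{R}^{n \times d}$ is called an $(n,d,\delta,\varepsilon)$-JL sketching operator if $R^T$ has this property, i.e. $\Pr\left[\left|\|x^TR\|^2-\|x\|^2\right| > \varepsilon \|x\|^2\right] < \delta$ for every fixed $x\in\mathbb{R}^n$.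 *)

(* Defs.v *)
From HB Require Import structures.
From mathcomp Require Import all_boot all_order all_algebra.
From mathcomp Require Import all_classical all_reals all_analysis.
From mathcomp Require Import complex.

Set Implicit Arguments.
Unset Strict Implicit.
Unset Printing Implicit Defensive.

Import Order.TTheory GRing.Theory Num.Theory.
Import numFieldNormedType.Exports.

Local Open Scope classical_set_scope.
Local Open Scope ring_scope.
Local Open Scope complex_scope.
Local Open Scope sesquilinear_scope.

Definition penrose (C : numClosedFieldType) m n
    (Y : 'M[C]_(m, n)) (X : 'M[C]_(n, m)) : Prop :=
  [/\ Y *m X *m Y = Y,
      X *m Y *m X = X,
      (Y *m X) ^t* = Y *m X &
      (X *m Y) ^t* = X *m Y].

(* The default value 0 is never used: see [pinvP] and [penrose_uniq]. *)
Definition pinv (C : numClosedFieldType) m n (Y : 'M[C]_(m, n)) :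
    'M[C]_(n, m) :=
  xget 0 [set X | penrose Y X].

Definition orthproj (C : numClosedFieldType) m n (Y : 'M[C]_(m, n)) : 'M[C]_m :=
  Y *m pinv Y.

Lemma trmxC_mul (C : numClosedFieldType) m n p
    (A : 'M[C]_(m, n)) (B : 'M[C]_(n, p)) :
  (A *m B) ^t* = B ^t* *m A ^t*.
Proof. by rewrite trmx_mul map_mxM. Qed.

Lemma mulmx_trC_eq0 (C : numClosedFieldType) m n (A : 'M[C]_(m, n)) :
  A *m A ^t* = 0 -> A = 0.
Proof.
move=> A0; apply/matrixP => i j; rewrite mxE.
have := congr1 (fun M : matrix C m m => M i i) A0; rewrite /= !mxE.
under eq_bigr do rewrite !mxE -normCK.
move/psumr_eq0P => /(_ (fun k _ => exprn_ge0 2 (normr_ge0 (A i k)))).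
by move=> /(_ j isT)/eqP; rewrite sqrf_eq0 normr_eq0 => /eqP.
Qed.

Lemma row_free_gram_unit (C : numClosedFieldType) m n (A : 'M[C]_(m, n)) :
  row_free A -> A *m A ^t* \in unitmx.
Proof.
move=> Af; rewrite -row_free_unit -kermx_eq0; apply/eqP.
set K := kermx _; have KA : K *m A = 0.
  by apply: mulmx_trC_eq0; rewrite trmxC_mul mulmxA -(mulmxA K) mulmx_ker mul0mx.
by apply: (row_free_inj Af); rewrite KA mul0mx.
Qed.

Lemma penrose_uniq (C : numClosedFieldType) m n
    (Y : 'M[C]_(m, n)) (X Z : 'M[C]_(n, m)) :
  penrose Y X -> penrose Y Z -> X = Z.
Proof.
move=> [X1 X2 X3 X4] [Z1 Z2 Z3 Z4].
have E1 : Y *m X = Y *m Z.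
  have := congr1 (mulmx^~ X) Z1; rewrite /= -mulmxA => <-.
  by rewrite -[LHS]trmxCK trmxC_mul X3 Z3 mulmxA X1.
have E2 : X *m Y = Z *m Y.
  have := congr1 (mulmx X) Z1; rewrite -mulmxA mulmxA => <-.
  by rewrite -[LHS]trmxCK trmxC_mul X4 Z4 -mulmxA (mulmxA Y) X1.
by rewrite -X2 -mulmxA E1 mulmxA E2 Z2.
Qed.

Lemma pinvP (C : numClosedFieldType) m n (Y : 'M[C]_(m, n)) :
  penrose Y (pinv Y).
Proof.
suff [X YX] : exists X, penrose Y X by apply: (xgetPex 0 (P := penrose Y)); exists X.
set B := col_base Y; set D := row_base Y.
have YE : Y = B *m D by rewrite mulmx_base.
have uD : D *m D ^t* \in unitmx.
  by apply: row_free_gram_unit; exact: row_base_free.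
have uB : B ^t* *m B \in unitmx.
  rewrite -{2}[B]trmxCK row_free_gram_unit// row_free_map /row_free mxrank_tr.
  exact: col_base_full.
move: (\rank Y) B D uB uD YE => k B D uB uD ->.
have invC p (G : 'M[C]_(p, p)) : (invmx G) ^t* = invmx (G ^t*).
  by rewrite trmx_inv map_invmx.
have YX : B *m D *m (D ^t* *m invmx (D *m D ^t*) *m invmx (B ^t* *m B) *m B ^t*)
    = B *m invmx (B ^t* *m B) *m B ^t*.
  by rewrite !mulmxA -(mulmxA B D) mulmxK.
have XY : D ^t* *m invmx (D *m D ^t*) *m invmx (B ^t* *m B) *m B ^t* *m (B *m D)
    = D ^t* *m invmx (D *m D ^t*) *m D.
  by rewrite !mulmxA -(mulmxA _ (B ^t*) B) mulmxKV.
exists (D ^t* *m invmx (D *m D ^t*) *m invmx (B ^t* *m B) *m B ^t*).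
split.
- by rewrite YX !mulmxA -(mulmxA _ (B ^t*) B) mulmxKV.
- by rewrite XY !mulmxA -(mulmxA _ D (D ^t*)) mulmxKV.
- by rewrite YX !trmxC_mul invC trmxC_mul trmxCK mulmxA.
- by rewrite XY !trmxC_mul invC trmxC_mul trmxCK mulmxA.
Qed.

Definition vnorm (R : realType) n (x : 'cV[R]_n) : R :=
  Num.sqrt (\sum_(i < n) x i 0 ^+ 2).

(* The modulus in [R[i]] takes values in [R[i]]; [complex.Re] brings it to [R]. *)
Definition cvnorm (R : realType) n (x : 'cV[R[i]]_n) : R :=
  Num.sqrt (\sum_(i < n) complex.Re `|x i 0| ^+ 2).

Definition spectral_norm (R : realType) m n (A : 'M[R[i]]_(m, n)) : R :=
  sup [set cvnorm (A *m x) | x in [set x : 'cV[R[i]]_n | cvnorm x <= 1]].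

(* [spectral_diag] lists the eigenvalues of the Hermitian matrix A^* A with
   multiplicity; they are nonnegative reals.  There are n of them, so for
   m < n the list carries n - m extra zeros at its end. *)
Definition singular_values (R : realType) m n (A : 'M[R[i]]_(m, n)) : seq R :=
  sort >=%R
    [seq Num.sqrt (complex.Re (spectral_diag (A ^t* *m A) 0 i)) | i <- enum 'I_n].

(* Numbered from 1: [singular_value A 1] is the largest one. *)
Definition singular_value (R : realType) m n (A : 'M[R[i]]_(m, n)) (j : nat) : R :=
  nth 0 (singular_values A) j.-1.

Definition random_matrix (R : realType) (dT : measure_display)
    (T : measurableType dT) k l (S : T -> 'M[R]_(k, l)) : Prop :=
  forall i j, measurable_fun [set: T] (fun w => S w i j).

Definition JL_sketching (R : realType) (dT : measure_display)
    (T : measurableType dT) (P : probability T R) (n d : nat) (delta eps : R)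
    (S : T -> 'M[R]_(d, n)) : Prop :=
  random_matrix S /\
  forall x : 'cV[R]_n,
    (P [set w | `|vnorm (S w *m x) ^+ 2 - vnorm x ^+ 2|%R
                  > eps * vnorm x ^+ 2]%R < delta%:E)%E.

Definition JL_sketching_right (R : realType) (dT : measure_display)
    (T : measurableType dT) (P : probability T R) (n d : nat) (delta eps : R)
    (S : T -> 'M[R]_(n, d)) : Prop :=
  JL_sketching P delta eps (fun w => (S w)^T).

(* Main.v *)
Require Import Defs.
From mathcomp Require Import all_boot all_order all_algebra.
From mathcomp Require Import all_classical all_reals all_analysis.
From mathcomp Require Import measurable_realfun complex ring lra zify.

(* The projector residual is at most |A x - A R z| for every z, so it suffices to
   find a good z for each x.  Let E have as rows the q <= r right singular
   vectors of A with singular value above sigma_(r+1), and take the z of least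
   norm with E R z = E x.  Then x - R z is orthogonal to these vectors, so A
   stretches it by at most sigma_(r+1); its length is controlled by the Frobenius
   norm of R (JL at the n standard basis vectors) and by a lower bound for R^T on
   the range of E^*.  That lower bound is the subspace embedding property on a
   real space of dimension k = 2 q, obtained from JL on at most 5^k vectors:
   integer points Z near the sphere |y|^2 = k/16.  A quadratic form that is
   nonnegative at all such Z is at y at least minus the error of rounding y
   coordinate by coordinate, which is a quarter of the trace. *)

Set Implicit Arguments.
Unset Strict Implicit.
Unset Printing Implicit Defensive.

Import Order.TTheory GRing.Theory Num.Theory.

Local Open Scope classical_set_scope.
Local Open Scope ring_scope.
Local Open Scope complex_scope.
Local Open Scope sesquilinear_scope.

(** * Counting the grid points *)

(** The product is about 0.93; the exponent 16 is the factor in [grid_points]. *)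
Lemma five_pow_bound (F : realFieldType) :
  0 <= 5 * (9 / 10) ^+ 16 :> F /\ 5 * (9 / 10) ^+ 16 <= 1 :> F.
Proof.
split; first by rewrite mulr_ge0// exprn_ge0//; lra.
rewrite (_ : 16 = 2 * 2 * 2 * 2)%N// !exprM.
by rewrite (_ : (9 / 10) ^+ 2 = 81 / 100 :> F); lra.
Qed.

Lemma sum_expr_pred_le (F : realFieldType) b :
  \sum_(j < b) (5^-1 : F) ^+ (j - 1) <= 9 / 4.
Proof.
(* Truncated subtraction gives j = 0 and j = 1 both weight 1, so the full series is 1 + 5/4. The
   induction carries the rest of the series, 5/4 * 5^-b. *)
suff: \sum_(j < b.+1) (5^-1 : F) ^+ (j - 1) + 5^-1 ^+ b / 4 * 5 <= 9 / 4.
  rewrite big_ord_recr /=; apply: le_trans.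
  by rewrite -addrA lerDl addr_ge0 ?mulr_ge0 ?exprn_ge0 ?invr_ge0.
elim: b => [|b IH]; first by rewrite big_ord1 /= !expr0; lra.
rewrite big_ord_recr /= subSS subn0; apply: le_trans IH.
by rewrite exprS; set s := \sum_(_ < _) _; set t := _ ^+ b; lra.
Qed.

(* [bool * 'I_b] encodes the integers in ]-b, b[, with two codes for zero.  The
   condition holds after rounding the coordinates of a vector [y] with
   [|y|^2 = k / 16] up or down, since [|Z_i| - 1 <= floor |y_i| <= y_i ^ 2]. *)
Definition grid_points k b : {set {ffun 'I_k -> bool * 'I_b}} :=
  [set f : {ffun 'I_k -> bool * 'I_b} | (16 * \sum_i ((f i).2 - 1) <= k)%N].

(* Chernoff: the weights [5^-(j-1)] of the signed integers below [b] add up to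
   at most 9/2, and [5 * (9/10)^16 <= 1]. *)
Lemma card_grid_points_field (F : realFieldType) k b :
  #|grid_points k b|%:R <= 5 ^+ k :> F.
Proof.
pose W (x : bool * 'I_b) : F := 5^-1 ^+ (x.2 - 1).
have W0 x : 0 <= W x by rewrite exprn_ge0// invr_ge0.
have WS : \sum_x W x <= 9 / 2.
  rewrite -(pair_bigA _ (fun (_ : bool) (j : 'I_b) => 5^-1 ^+ (j - 1))) /=.
  by rewrite big_bool /=; have := sum_expr_pred_le F b; lra.
have SW : \sum_(f : {ffun 'I_k -> bool * 'I_b}) \prod_i W (f i) <= (9 / 2) ^+ k.
  rewrite -(bigA_distr_bigA (fun _ => W)) /=.
  rewrite -[k in leRHS]card_ord -prodr_const ler_prod// => i _.
  by rewrite WS sumr_ge0.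
(* At a grid point the product of the weights is 5^-t with 16 t <= k, so 5^(k %/ 16) times it is at
   least 1. *)
have step : #|grid_points k b|%:R <= 5 ^+ (k %/ 16) * (9 / 2) ^+ k :> F.
  apply: le_trans (ler_wpM2l _ SW); last exact: exprn_ge0.
  rewrite mulr_sumr -sum1_card natr_sum big_mkcond /= ler_sum// => f _.
  have P0 : 0 <= \prod_i W (f i) by exact: prodr_ge0.
  case: ifPn => [|_]; last by rewrite mulr_ge0 ?exprn_ge0.
  rewrite inE /W prodrXr => fk.
  rewrite exprVn ler_pdivlMr ?exprn_gt0// mul1r ler_weXn2l//; first lra.
  by rewrite leq_divRL// mulnC.
apply: (le_trans step).
have k16 : (16 * (k %/ 16) <= k)%N by rewrite mulnC leq_trunc_div.
have -> : 9 / 2 = 5 * (9 / 10) :> F by lra.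
rewrite exprMn mulrCA ler_piMr ?exprn_ge0//.
apply: (@le_trans _ _ (5 ^+ (k %/ 16) * (9 / 10) ^+ (16 * (k %/ 16)))).
  by rewrite ler_wpM2l ?exprn_ge0// ler_wiXn2l//; lra.
rewrite exprM -exprMn.
by have [c0 c1] := five_pow_bound F; rewrite exprn_ile1.
Qed.

Lemma card_grid_points k b : (#|grid_points k b| <= 5 ^ k)%N.
Proof. by rewrite -(ler_nat rat) natrX card_grid_points_field. Qed.

(** * Quadratic forms and coordinatewise rounding *)

Definition qform (F : comNzRingType) k (M : 'M[F]_k) (y : 'cV[F]_k) : F :=
  (y^T *m M *m y) 0 0.

Lemma qformD_delta (F : comNzRingType) k (M : 'M[F]_k) (y : 'cV[F]_k) a t :
  qform M (y + t *: delta_mx a 0) =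
  qform M y + t * ((y^T *m M) 0 a + (M *m y) a 0) + t ^+ 2 * M a a.
Proof.
rewrite /qform.
have -> : (y + t *: delta_mx a 0)^T = y^T + t *: delta_mx 0 a.
  by rewrite linearD linearZ /= trmx_delta.
rewrite !mulmxDl !mulmxDr.
rewrite -!scalemxAr -!scalemxAl -!rowE -!colE -[col a (row a M)]/(col a (row a M)).
rewrite !mxE /=.
rewrite [in \sum_j row _ _ _ _ * _](eq_bigr (fun j => M a j * y j 0));
  last by move=> j _; rewrite mxE.
by rewrite mulrDr expr2 -mulrA !addrA.
Qed.

(* Randomized rounding of a number at distance [th] from its floor has mean
   zero error and variance [th * (1 - th) <= 1/4]. *)
Lemma rounding_step (F : realFieldType) (th l c : F) :
  0 <= th <= 1 -> 0 <= c ->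
  - th * l + th ^+ 2 * c <= c / 4 \/ (1 - th) * l + (1 - th) ^+ 2 * c <= c / 4.
Proof.
move=> /andP[th0 th1] c0.
case: (lerP (- th * l + th ^+ 2 * c) (c / 4)) => [|h1]; first by left.
case: (lerP ((1 - th) * l + (1 - th) ^+ 2 * c) (c / 4)) => [|h2]; first by right.
exfalso; move: h1; case: (eqVneq th 0) => [->|thN0]; first by nra.
have {thN0}th_gt0 : 0 < th by rewrite lt0r thN0.
rewrite -subr_gt0 => h1; move: h2; rewrite -subr_gt0 => h2.
(* Weighting the two inequalities by 1 - th and th cancels [l] and leaves th * (1 - th) * c > c /
   4. *)
have m1 := mulr_ge0 (_ : 0 <= 1 - th) (ltW h1); have {m1}m1 := m1 ltac:(lra).
have m2 := mulr_gt0 th_gt0 h2.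
have m3 := mulr_ge0 c0 (sqr_ge0 (th - 2^-1)).
by lra.
Qed.

Definition grid_val (F : pzRingType) b (x : bool * 'I_b) : F :=
  (-1) ^+ x.1 * (nat_of_ord x.2)%:R.

Definition grid_vec (F : pzRingType) k b (f : {ffun 'I_k -> bool * 'I_b}) : 'cV[F]_k :=
  \col_i grid_val F (f i).

Lemma round_coord (F : archiRealFieldType) b (y l c : F) :
  0 <= c -> (Num.truncn `|y| + 1 < b)%N ->
  exists x : bool * 'I_b, (x.2 - 1 <= Num.truncn `|y|)%N /\
    (grid_val F x - y) * l + (grid_val F x - y) ^+ 2 * c <= c / 4.
Proof.
move=> c0 yb; set j := Num.truncn _ in yb *.
have /andP[j0 j1] : j%:R <= `|y| < j.+1%:R by exact: truncn_itv.
have th01 : 0 <= `|y| - j%:R <= 1.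
  by move: j1; rewrite -natr1; lra.
have ys : y = (-1) ^+ (y < 0)%R * `|y| by rewrite -numEsign.
have jb : (j < b)%N by lia.
have j1b : (j.+1 < b)%N by lia.
have s2 : ((-1) ^+ (y < 0)%R) ^+ 2 = 1 :> F by rewrite sqrr_sign.
set s := (-1) ^+ (y < 0)%R in ys s2.
case: (rounding_step (s * l) th01 c0) => h.
  exists ((y < 0)%R, Ordinal jb); split; first exact: leq_subr.
  rewrite /grid_val /= -/s ys -mulrBr exprMn s2.
  by move: h; set a := `|y|; nra.
exists ((y < 0)%R, Ordinal j1b); split; first by rewrite /=; lia.
rewrite /grid_val /= -/s ys -mulrBr exprMn s2.
by move: h; rewrite -natr1; set a := `|y|; nra.
Qed.

(** Derandomized rounding, one coordinate at a time. When one coordinate moves, the off-diagonal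
    entries enter only the linear term, and [round_coord] picks the direction for which the cost is
    at most a quarter of the diagonal entry. *)
Lemma round_qform (F : archiRealFieldType) k b (M : 'M[F]_k) (y : 'cV[F]_k) :
  (forall i, 0 <= M i i) -> (forall i, (Num.truncn `|y i 0%R| + 1 < b)%N) ->
  exists f : {ffun 'I_k -> bool * 'I_b},
    (forall i, ((f i).2 - 1 <= Num.truncn `|y i 0%R|)%N) /\
    qform M (grid_vec F f) <= qform M y + (\sum_i M i i) / 4.
Proof.
move=> M0 yb.
suff /(_ k (leqnn k))[f [z [f1 fz zy fM]]] : forall s : nat, (s <= k)%N ->
   exists f : {ffun 'I_k -> bool * 'I_b}, exists z : 'cV[F]_k,
   [/\ forall i, ((f i).2 - 1 <= Num.truncn `|y i 0%R|)%N,
       forall i : 'I_k, (i < s)%N -> z i 0 = grid_val F (f i),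
       forall i : 'I_k, (s <= i)%N -> z i 0 = y i 0 &
       qform M z <= qform M y + (\sum_(i < k | (i < s)%N) M i i) / 4].
  exists f; split=> //.
  have -> : grid_vec F f = z by apply/colP => i; rewrite mxE fz.
  rewrite [X in _ + X / _](eq_bigl (fun i : 'I_k => (i < k)%N))// => i.
  by rewrite ltn_ord.
elim => [_|s IH sk].
  (* Coordinates not yet rounded carry a placeholder code of zero. *)
  have b0 (i : 'I_k) : (0 < b)%N by have := yb i; lia.
  exists [ffun i => (true, Ordinal (b0 i))], y; split => // [i|].
    by rewrite ffunE.
  by rewrite big_pred0 ?mul0r ?addr0// => i; rewrite ltn0.
have [|f [z [f1 fz zy fM]]] := IH; first exact: ltnW.
pose a := Ordinal sk.
have [x [x1 x2]] := round_coord ((z^T *m M) 0 a + (M *m z) a 0) (M0 a) (yb a).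
exists [ffun i => if i == a then x else f i], (z + (grid_val F x - y a 0) *: delta_mx a 0).
have za : z a 0 = y a 0 by rewrite zy.
split => [i|i|i|].
- by rewrite ffunE; case: eqP => [->|].
- rewrite ffunE ltnS !mxE eqxx andbT => ia.
  case: eqVneq => [->|iNa]; first by rewrite za mulr1 addrC subrK.
  rewrite mulr0 addr0 fz// ltn_neqAle ia andbT.
  by apply: contra_neq iNa => is_; exact: val_inj.
- move=> si; rewrite !mxE eqxx andbT.
  have -> : (i == a) = false by apply/eqP => ia; move: si; rewrite ia /= ltnn.
  by rewrite mulr0 addr0 zy// ltnW.
- rewrite qformD_delta (bigD1 a)//=.
  have -> : \sum_(i < k | (i < s.+1)%N && (i != a)) M i i = \sum_(i < k | (i < s)%N) M i i.
    apply: eq_bigl => i; rewrite ltnS ltn_neqAle andbC.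
    by congr (~~ _ && _).
  by move: fM x2; set u := \sum_(_ < _ | _) _; set v := qform M z;
     set w := _ + (M *m z) a 0; lra.
Qed.

(** * Squared norms and the lower bound obtained from grid points *)

Definition nrm2 (F : pzRingType) n (x : 'cV[F]_n) : F := \sum_i x i 0 ^+ 2.

Lemma nrm2_mx (F : comNzRingType) n (x : 'cV[F]_n) : nrm2 x = (x^T *m x) 0 0.
Proof. by rewrite mxE; apply: eq_bigr => i _; rewrite mxE expr2. Qed.

Lemma nrm2Z (F : comNzRingType) n c (x : 'cV[F]_n) : nrm2 (c *: x) = c ^+ 2 * nrm2 x.
Proof. by rewrite mulr_sumr; apply: eq_bigr => i _; rewrite mxE exprMn. Qed.

Lemma nrm2_ge0 (F : realDomainType) n (x : 'cV[F]_n) : 0 <= nrm2 x.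
Proof. by apply: sumr_ge0 => i _; exact: sqr_ge0. Qed.

Lemma nrm2_vnorm (R : realType) n (x : 'cV[R]_n) : vnorm x ^+ 2 = nrm2 x.
Proof. by rewrite sqr_sqrtr// nrm2_ge0. Qed.

Lemma nrm2_delta (F : pzRingType) n (i : 'I_n) : nrm2 (delta_mx i 0 : 'cV[F]_n) = 1.
Proof.
rewrite /nrm2 (bigD1 i)//= mxE !eqxx expr1n big1 ?addr0// => j /negPf ji.
by rewrite mxE ji expr0n.
Qed.

Lemma qform_delta (F : comNzRingType) k (M : 'M[F]_k) i :
  qform M (delta_mx i 0) = M i i.
Proof. by rewrite /qform trmx_delta -rowE -colE !mxE. Qed.

(** Entries 0 and 1 add nothing to the sum in [grid_points]. Unit vectors as test points give
    control of the diagonal of a quadratic form. *)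
Lemma delta_grid (F : pzRingType) k (i : 'I_k) :
  exists2 f, f \in grid_points k k.+2 & grid_vec F f = delta_mx i 0.
Proof.
exists [ffun j => (false, if j == i then lift ord0 ord0 else ord0)].
  rewrite inE big1 ?muln0// => j _; rewrite ffunE /=.
  by case: (j == i).
by apply/colP => j; rewrite !mxE ffunE /grid_val /= expr0 mul1r eqxx andbT; case: (j == i).
Qed.

(** The form |S B z|^2 - (1 - e) |B z|^2 is nonnegative at grid points, and its values at the unit
    vectors put its diagonal entries between 0 and 2 e. Rounding a multiple of [y] to a grid point
    then bounds it from below at [y]. *)
Lemma net_lower_bound (R : realType) n d k (B : 'M[R]_(n, k)) (S : 'M[R]_(d, n)) e y :
  0 <= e -> (forall z, nrm2 (B *m z) <= nrm2 z) ->
  (forall f, f \in grid_points k k.+2 ->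
    `|nrm2 (S *m (B *m grid_vec R f)) - nrm2 (B *m grid_vec R f)|
      <= e * nrm2 (B *m grid_vec R f)) ->
  nrm2 (B *m y) - 9 * e * nrm2 y <= nrm2 (S *m (B *m y)).
Proof.
move=> e0 B1 JL.
pose M := (S *m B)^T *m (S *m B) - (1 - e) *: (B^T *m B).
have qM z : qform M z = nrm2 (S *m (B *m z)) - (1 - e) * nrm2 (B *m z).
  rewrite /qform /M mulmxBr mulmxBl -scalemxAr -scalemxAl !nrm2_mx !trmx_mul !mulmxA.
  by rewrite [LHS]mxE; congr (_ + _); rewrite !mxE.
have qM0 f : f \in grid_points k k.+2 ->
    0 <= qform M (grid_vec R f) <= 2 * e * nrm2 (B *m grid_vec R f).
  by move=> /JL; rewrite qM ler_norml => /andP[h1 h2]; apply/andP; split; lra.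
have Mi i : 0 <= M i i <= 2 * e.
  have [f /qM0/andP[f0 f1] fE] := delta_grid R i.
  rewrite fE qform_delta in f0 f1; rewrite f0 (le_trans f1)//.
  by rewrite ler_piMr ?mulr_ge0// (le_trans (B1 _))// nrm2_delta.
have [y0|yN0] := eqVneq (nrm2 y) 0.
  by have := nrm2_ge0 (S *m (B *m y)); have := B1 y; rewrite y0; lra.
have yp : 0 < nrm2 y by rewrite lt0r yN0 nrm2_ge0.
have k0 : (0 < k)%N.
  case: k y yN0 {yp B S JL B1 M qM qM0 Mi} => // y.
  by rewrite /nrm2 big_ord0 eqxx.
(* At squared length k / 16 rounding yields a grid point, and all coordinates fit the codes below k
   + 2. *)
pose c := Num.sqrt (k%:R / 16 / nrm2 y).
have c2 : c ^+ 2 * nrm2 y = k%:R / 16.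
  by rewrite sqr_sqrtr ?divfK// divr_ge0 ?nrm2_ge0// divr_ge0.
have cy2 i : (c *: y) i 0 ^+ 2 <= k%:R / 16.
  rewrite -c2 -nrm2Z /nrm2 (bigD1 i)//= lerDl sumr_ge0// => j _; exact: sqr_ge0.
have tr i : (Num.truncn `|(c *: y) i 0%R|)%:R <= `|(c *: y) i 0| :> R.
  by have /andP[] := truncn_itv (normr_ge0 ((c *: y) i 0)).
have tr2 i : (Num.truncn `|(c *: y) i 0%R|)%:R <= (c *: y) i 0 ^+ 2 :> R.
  rewrite -(real_normK (num_real _)); apply: le_trans (lerXn2r 2 _ _ (tr i));
    rewrite ?nnegrE//.
  by rewrite -natrX ler_nat; case: Num.truncn => // q; rewrite leq_pmulr.
have ltb i : (Num.truncn `|(c *: y) i 0%R| + 1 < k.+2)%N.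
  rewrite addn1 !ltnS -(ler_nat R) (le_trans (tr2 i))// (le_trans (cy2 i))//.
  by have := ler0n R k; lra.
have [f [f1 f2]] := round_qform (fun i => proj1 (andP (Mi i))) ltb.
have fg : f \in grid_points k k.+2.
  rewrite inE -(ler_nat R) natrM natr_sum.
  apply: (@le_trans _ _ (16 * nrm2 (c *: y))); last first.
    by rewrite nrm2Z c2 mulrC divfK.
  by rewrite ler_wpM2l// ler_sum// => i _; rewrite (le_trans _ (tr2 i))// ler_nat.
have /andP[g0 _] := qM0 _ fg.
have tM : \sum_i M i i <= k%:R * (2 * e).
  apply: (@le_trans _ _ (\sum_(i < k) 2 * e)); last first.
    by rewrite sumr_const card_ord [in leRHS]mulr_natl.
  by apply: ler_sum => i _; have /andP[] := Mi i.
have qcy : qform M (c *: y) = c ^+ 2 * qform M y.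
  by rewrite !qM -!scalemxAr !nrm2Z; ring.
(* A quarter of the trace is at most k * e / 2 = 8 * e * c^2 * |y|^2. The ninth e comes from the
   factor 1 - e in [M]. *)
have h : 0 <= c ^+ 2 * (qform M y + 8 * e * nrm2 y).
  have -> : c ^+ 2 * (qform M y + 8 * e * nrm2 y) = qform M (c *: y) + 8 * e * (c ^+ 2 * nrm2 y).
    by rewrite qcy; ring.
  by rewrite c2; lra.
have cp : 0 < c ^+ 2.
  rewrite lt0r sqr_ge0 andbT; apply/eqP => c0; move: c2; rewrite c0 mul0r.
  by move: k0; rewrite -(ltr_nat R); lra.
move: h; rewrite pmulr_rge0// qM.
have := ler_wpM2l e0 (B1 y).
lra.
Qed.

(** * Orthonormalizing real columns *)

Lemma row_mx_gram (F : comNzRingType) n k (b : 'cV[F]_n) (B : 'M[F]_(n, k)) :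
  row_mx b B *m (row_mx b B)^T = b *m b^T + B *m B^T.
Proof. by rewrite tr_row_mx mul_row_col. Qed.

(* Gram-Schmidt without discarding dependent columns: they become zero, so [B]
   is only a partial isometry. *)
Lemma orthonormalize (F : rcfType) n k (X : 'M[F]_(n, k)) :
  exists B : 'M[F]_(n, k), B *m B^T *m B = B /\ B *m B^T *m X = X.
Proof.
elim: k X => [|k IH] X; first by exists 0; split; apply/matrixP => i [].
rewrite -[X](@hsubmxK _ _ 1 k).
move: (lsubmx (X : 'M[F]_(n, 1 + k))) (rsubmx (X : 'M[F]_(n, 1 + k))).
move=> {}x {}X; have [B [B1 B2]] := IH X.
have B1' : B^T *m B *m B^T = B^T.
  by rewrite -[RHS](congr1 trmx B1) !trmx_mul trmxK mulmxA.
pose u := x - B *m B^T *m x.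
have Bu : B^T *m u = 0 by rewrite mulmxBr !mulmxA B1' subrr.
have [b [Bb bu]] : exists b : 'cV[F]_n,
    B^T *m b = 0 /\ b *m b^T *m u = u /\ b *m b^T *m b = b.
  have [u0|uN0] := eqVneq u 0.
    by exists 0; rewrite u0 !mulmx0; split.
  have up : 0 < nrm2 u.
    rewrite lt0r nrm2_ge0 andbT; apply: contra_neq uN0 => /eqP.
    rewrite psumr_eq0 => [/allP u0|i _]; last exact: sqr_ge0.
    apply/colP => i; have := u0 i (mem_index_enum i).
    by rewrite sqrf_eq0 => /eqP ->; rewrite mxE.
  have uu : u^T *m u = (nrm2 u)%:M by apply/matrixP => i j; rewrite !ord1 -nrm2_mx !mxE eqxx.
  pose c := (Num.sqrt (nrm2 u))^-1.
  have c2 : c * c * nrm2 u = 1.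
    by rewrite -expr2 exprVn sqr_sqrtr ?mulVf ?gt_eqF// ltW.
  exists (c *: u); split; first by rewrite -scalemxAr Bu scaler0.
  have h : c *: u *m (c *: u)^T *m u = u.
    rewrite linearZ /= -!scalemxAl -scalemxAr -scalemxAl -mulmxA uu.
    by rewrite mul_mx_scalar !scalerA c2 scale1r.
  by split => //; rewrite -scalemxAr h.
case: bu => bu bb.
have bB : b^T *m B = 0 by rewrite -[LHS]trmxK trmx_mul trmxK Bb trmx0.
have mulrow (M : 'M[F]_n) (y : 'cV[F]_n) (Y : 'M[F]_(n, k)) :
    M *m (row_mx y Y : 'M[F]_(n, k.+1)) = row_mx (M *m y) (M *m Y).
  exact: (mul_mx_row M y Y).
exists (row_mx b B); rewrite row_mx_gram !mulrow !mulmxDl bb B1 B2.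
have -> : b *m b^T *m B = 0 by rewrite -mulmxA bB mulmx0.
have -> : B *m B^T *m b = 0 by rewrite -mulmxA Bb mulmx0.
rewrite addr0 add0r; split=> //.
have -> : b *m b^T *m X = 0.
  by rewrite -B2 !mulmxA -(mulmxA b) bB mulmx0 !mul0mx.
suff -> : b *m b^T *m x + B *m B^T *m x = x by rewrite add0r.
rewrite -{1}[x](subrK (B *m B^T *m x)) -/u mulmxDr bu.
by rewrite !mulmxA -(mulmxA b b^T B) bB mulmx0 !mul0mx addr0 subrK.
Qed.

(** [B^T *m B] is an orthogonal projector, so by Pythagoras the gap is the squared norm of the
    complementary component of [z]. *)
Lemma partial_isometry_contract (F : realFieldType) n k (B : 'M[F]_(n, k)) z :
  B *m B^T *m B = B -> nrm2 (B *m z) <= nrm2 z.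
Proof.
move=> B1; rewrite -subr_ge0.
suff -> : nrm2 z - nrm2 (B *m z) = nrm2 (z - B^T *m B *m z) by exact: nrm2_ge0.
set G := B^T *m B; have GT : G^T = G by rewrite trmx_mul trmxK.
have GG : G *m G = G by rewrite /G mulmxA -(mulmxA _ B) -(mulmxA B^T) B1.
have -> : nrm2 (B *m z) = (z^T *m (G *m z)) 0 0 by rewrite nrm2_mx trmx_mul !mulmxA.
have -> : nrm2 (z - G *m z) = ((z^T - z^T *m G) *m (z - G *m z)) 0 0.
  by rewrite nrm2_mx [(_ - _)^T]linearB /= trmx_mul GT.
clearbody G; rewrite mulmxBr !mulmxBl -!mulmxA (mulmxA G G) GG subrr subr0 nrm2_mx.
by rewrite !mxE.
Qed.

(** * Complex vectors as a real inner product space *)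

(** The Euclidean inner product of C^n seen as R^(2n); its values lie in the ordered field [R]. *)
Definition cdot (R : realType) n (x y : 'cV[R[i]]_n) : R := complex.Re ((x ^t* *m y) 0 0).

Definition cnrm2 (R : realType) n (x : 'cV[R[i]]_n) : R := cdot x x.

Lemma Re_conj_mul (R : realType) (a b : R[i]) :
  complex.Re (a^* * b) = complex.Re a * complex.Re b + complex.Im a * complex.Im b.
Proof. by case: a b => [a1 a2] [b1 b2] /=; ring. Qed.

Lemma Re_sum (R : realType) I (r : seq I) (f : I -> R[i]) :
  complex.Re (\sum_(i <- r) f i) = \sum_(i <- r) complex.Re (f i).
Proof. by rewrite (big_morph _ (fun x y => raddfD _ x y) (raddf0 _)). Qed.

Lemma cdotE (R : realType) n (x y : 'cV[R[i]]_n) :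
  cdot x y = \sum_i (complex.Re (x i 0) * complex.Re (y i 0) +
                     complex.Im (x i 0) * complex.Im (y i 0)).
Proof.
rewrite /cdot mxE Re_sum; apply: eq_bigr => i _.
by rewrite !mxE -Re_conj_mul.
Qed.

Lemma cdotC (R : realType) n (x y : 'cV[R[i]]_n) : cdot x y = cdot y x.
Proof. by rewrite !cdotE; apply: eq_bigr => i _; ring. Qed.

Lemma cdotDr (R : realType) n (x y z : 'cV[R[i]]_n) : cdot x (y + z) = cdot x y + cdot x z.
Proof. by rewrite /cdot mulmxDr mxE raddfD. Qed.

Lemma cdotZr (R : realType) n c (x y : 'cV[R[i]]_n) : cdot x (c%:C *: y) = c * cdot x y.
Proof. by rewrite /cdot -scalemxAr mxE; case: (_ 0 0) => a b /=; ring. Qed.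

Lemma cdotNr (R : realType) n (x y : 'cV[R[i]]_n) : cdot x (- y) = - cdot x y.
Proof. by rewrite /cdot mulmxN mxE raddfN. Qed.

Lemma cdot_adj (R : realType) m n (M : 'M[R[i]]_(m, n)) x y :
  cdot x (M *m y) = cdot (M ^t* *m x) y.
Proof. by rewrite /cdot trmxC_mul trmxCK mulmxA. Qed.

Lemma cnrm2D (R : realType) n (x y : 'cV[R[i]]_n) :
  cnrm2 (x + y) = cnrm2 x + 2 * cdot x y + cnrm2 y.
Proof. by rewrite /cnrm2 cdotDr ![cdot (x + y) _]cdotC !cdotDr (cdotC y x); ring. Qed.

Lemma cnrm2N (R : realType) n (x : 'cV[R[i]]_n) : cnrm2 (- x) = cnrm2 x.
Proof. by rewrite /cnrm2 cdotNr cdotC cdotNr opprK. Qed.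

Lemma cnrm2B (R : realType) n (x y : 'cV[R[i]]_n) :
  cnrm2 (x - y) = cnrm2 x - 2 * cdot x y + cnrm2 y.
Proof. by rewrite cnrm2D cnrm2N cdotNr; ring. Qed.

Lemma cnrm2Z (R : realType) n c (x : 'cV[R[i]]_n) : cnrm2 (c%:C *: x) = c ^+ 2 * cnrm2 x.
Proof. by rewrite /cnrm2 cdotZr cdotC cdotZr; ring. Qed.

Lemma cnrm2_parts (R : realType) n (x : 'cV[R[i]]_n) :
  cnrm2 x = nrm2 (map_mx (@complex.Re R) x) + nrm2 (map_mx (@complex.Im R) x).
Proof.
rewrite /cnrm2 cdotE /nrm2 -big_split; apply: eq_bigr => i _.
by rewrite !mxE !expr2.
Qed.

Lemma cnrm2_ge0 (R : realType) n (x : 'cV[R[i]]_n) : 0 <= cnrm2 x.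
Proof. by rewrite cnrm2_parts addr_ge0// nrm2_ge0. Qed.

Lemma cvnormE (R : realType) n (x : 'cV[R[i]]_n) : cvnorm x = Num.sqrt (cnrm2 x).
Proof.
rewrite /cvnorm /cnrm2 cdotE; congr Num.sqrt; apply: eq_bigr => i _.
by rewrite normc_def /= sqr_sqrtr ?addr_ge0 ?sqr_ge0.
Qed.

Lemma cvnorm_ge0 (R : realType) n (x : 'cV[R[i]]_n) : 0 <= cvnorm x.
Proof. by rewrite cvnormE sqrtr_ge0. Qed.

Lemma sqr_cvnorm (R : realType) n (x : 'cV[R[i]]_n) : cvnorm x ^+ 2 = cnrm2 x.
Proof. by rewrite cvnormE sqr_sqrtr ?cnrm2_ge0. Qed.

Lemma cnrm2_eq0 (R : realType) n (x : 'cV[R[i]]_n) : cnrm2 x = 0 -> x = 0.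
Proof.
rewrite /cnrm2 cdotE => x0; apply/colP => i; rewrite mxE.
move/eqP: x0; rewrite psumr_eq0 => [/allP/(_ i (mem_index_enum i))|j _]; last first.
  by rewrite -!expr2 addr_ge0 ?sqr_ge0.
rewrite /= -!expr2 paddr_eq0 ?sqr_ge0// !sqrf_eq0.
by case: (x i 0) => a b /= /andP[/eqP -> /eqP ->].
Qed.

Lemma cnrm2_isometry (R : realType) m n (M : 'M[R[i]]_(m, n)) x :
  M ^t* *m M = 1%:M -> cnrm2 (M *m x) = cnrm2 x.
Proof. by move=> MM; rewrite /cnrm2 cdot_adj mulmxA MM mul1mx. Qed.

(** Weighted Young inequality, from |t x + y|^2 >= 0 divided by [t]. *)
Lemma cnrm2B_le (R : realType) n (x y : 'cV[R[i]]_n) (t : R) :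
  0 < t -> cnrm2 (x - y) <= (1 + t) * cnrm2 x + (1 + t^-1) * cnrm2 y.
Proof.
move=> t0; have h := cnrm2_ge0 (t%:C *: x + y).
rewrite cnrm2D cnrm2Z cdotC cdotZr in h.
have {h} : 0 <= t^-1 * (t ^+ 2 * cnrm2 x + 2 * (t * cdot y x) + cnrm2 y).
  by rewrite mulr_ge0// invr_ge0 ltW.
have -> : t^-1 * (t ^+ 2 * cnrm2 x + 2 * (t * cdot y x) + cnrm2 y) =
   t * cnrm2 x + 2 * cdot y x + t^-1 * cnrm2 y by field; rewrite gt_eqF.
by rewrite cnrm2B (cdotC x y); lra.
Qed.

(** * The deterministic residual bound *)

Lemma sketch_residual (R : realType) m n d q (A : 'M[R[i]]_(m, n)) (E : 'M[R[i]]_(q, n))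
    (W : 'M[R[i]]_(n, d)) (sg s rho : R) :
  E *m E ^t* = 1%:M -> 0 <= sg -> 0 < s -> 0 < rho ->
  (forall v, E *m v = 0 -> cnrm2 (A *m v) <= sg * cnrm2 v) ->
  (forall u, s * cnrm2 u <= cnrm2 (W ^t* *m (E ^t* *m u))) ->
  (forall z, cnrm2 (W *m z) <= rho * cnrm2 z) ->
  forall x, exists z, cnrm2 (A *m x - A *m W *m z) <= (1 + rho / s) * sg * cnrm2 x.
Proof.
move=> EE sg0 s0 rho0 tail low up x.
pose G := E *m W.
have Gu : G *m G ^t* \in unitmx.
  (* The lower bound for W^* E^* forces the left kernel of [G] to vanish. *)
  apply: row_free_gram_unit; rewrite -kermx_eq0; apply/eqP/row_matrixP => i.
  rewrite row0; set u := row i _.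
  have uG : u *m G = 0 by rewrite -row_mul mulmx_ker row0.
  have : cnrm2 (u ^t*) = 0.
    apply/eqP; rewrite eq_le cnrm2_ge0 andbT -(pmulr_rle0 _ s0) (le_trans (low _))//.
    by rewrite mulmxA -!trmxC_mul mulmxA -mulmxA uG trmx0 map_mx0 /cnrm2 /cdot mulmx0 mxE.
  by move/cnrm2_eq0 => /(congr1 (fun M => M ^t*)); rewrite trmxCK trmx0 map_mx0.
pose h := invmx (G *m G ^t*) *m (E *m x).
pose z := G ^t* *m h.
have Gz : G *m z = E *m x by rewrite mulmxA mulKVmx.
have zz : cnrm2 z = cdot h (E *m x).
  have -> : cnrm2 z = cdot z (G ^t* *m h) by [].
  by rewrite [LHS]cdot_adj trmxCK Gz cdotC.
(* Expand |E x - s h|^2 >= 0, using <h, E x> = |z|^2 and s |h|^2 <= |G^* h|^2 = |z|^2. *)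
have sz : s * cnrm2 z <= cnrm2 (E *m x).
  have := cnrm2_ge0 (E *m x - s%:C *: h).
  rewrite cnrm2B cnrm2Z cdotZr cdotC -zz => h1.
  have := ler_wpM2l (ltW s0) (low h); rewrite mulmxA -trmxC_mul -/G -/z.
  by lra.
exists z; clearbody z.
have Q (v : 'cV[R[i]]_n) : cnrm2 (v - E ^t* *m (E *m v)) = cnrm2 v - cnrm2 (E *m v).
  rewrite cnrm2B cdot_adj trmxCK -/(cnrm2 _).
  by rewrite (cnrm2_isometry (M := E ^t*)) ?trmxCK//; ring.
have tau0 : 0 < rho / s by rewrite divr_gt0.
have -> : A *m x - A *m W *m z = A *m (x - W *m z) by rewrite mulmxBr mulmxA.
have Ev : E *m (x - W *m z) = 0 by rewrite mulmxBr mulmxA Gz subrr.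
apply: (le_trans (tail _ Ev)); rewrite [_ * sg]mulrC -mulrA ler_wpM2l//.
(* Since E W z = E x, only the components of x and W z in the kernel of [E] remain. *)
have -> : x - W *m z = (x - E ^t* *m (E *m x)) - (W *m z - E ^t* *m (E *m (W *m z))).
  by rewrite (mulmxA E W) Gz opprB addrA subrK.
(* With the weight rho / s the two contributions of |E x|^2 cancel. *)
apply: (le_trans (cnrm2B_le _ _ tau0)); rewrite !Q.
have Wz : cnrm2 (W *m z) - cnrm2 (E *m (W *m z)) <= rho / s * cnrm2 (E *m x).
  rewrite lerBlDr (le_trans (up z))// -[leLHS]addr0 lerD ?cnrm2_ge0//.
  by rewrite -mulrA ler_pM2l// ler_pdivlMl.
have c0 : 0 <= 1 + (rho / s)^-1 by rewrite addr_ge0// invr_ge0 ltW.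
have := ler_wpM2l c0 Wz.
have -> : (1 + (rho / s)^-1) * (rho / s * cnrm2 (E *m x)) = (1 + rho / s) * cnrm2 (E *m x).
  by rewrite mulrA mulrDl mul1r mulVf ?gt_eqF// addrC.
by rewrite !mulrBr; lra.
Qed.

(** * Singular values and the spectral tail *)

Lemma count_gt_nth_sort (R : realDomainType) (s : seq R) k :
  (count (fun y => nth 0 (sort >=%R s) k < y)%R s <= k)%N.
Proof.
rewrite -(permP (permEl (perm_sort >=%R s))).
set t := sort _ _.
have ts : sorted >=%R t by apply: sort_sorted => a b; exact: le_total.
(* Past the end [nth] returns 0, and the length alone bounds the count. Otherwise no entry from
   position [k] on exceeds the one at [k]. *)
have [tk|kt] := leqP (size t) k; first exact: leq_trans (count_size _ _) tk.
rewrite -{2}(cat_take_drop k t) count_cat.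
have -> : count (fun y => nth 0 t k < y) (drop k t) = 0%N.
  apply/eqP; rewrite -leqn0 leqNgt -has_count; apply/hasPn => y /(nthP 0)[j].
  rewrite size_drop => jt <-; rewrite nth_drop -leNgt.
  apply: (sorted_leq_nth _ _ _ ts); rewrite ?inE ?leq_addr//.
  - by move=> a b c /= ba cb; exact: le_trans ba.
  - by move=> a /=.
  - by rewrite -ltn_subRL.
by rewrite addn0 (leq_trans (count_size _ _))// size_take kt.
Qed.

Lemma singular_value_ge0 (R : realType) m n (A : 'M[R[i]]_(m, n)) k :
  0 <= singular_value A k.
Proof.
rewrite /singular_value; have [ks|ks] := ltnP k.-1 (size (singular_values A));
  last by rewrite nth_default.
by have := mem_nth 0 ks; rewrite mem_sort => /mapP[i _ ->]; exact: sqrtr_ge0.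
Qed.

(** [E] collects the rows of the spectral matrix with singular value strictly above sigma_(r+1).
    Strictness keeps their number at most [r] when values repeat. *)
Lemma singular_tail (R : realType) m n (A : 'M[R[i]]_(m, n)) r :
  exists q, (q <= r)%N /\ exists E : 'M[R[i]]_(q, n), E *m E ^t* = 1%:M /\
    forall v, E *m v = 0 -> cnrm2 (A *m v) <= singular_value A r.+1 ^+ 2 * cnrm2 v.
Proof.
pose H := A ^t* *m A; pose U := spectralmx H.
pose sv i := Num.sqrt (complex.Re (spectral_diag H 0 i)).
pose I1 := [set i | singular_value A r.+1 < sv i]%SET.
have Uu : U \is unitarymx by exact: spectral_unitarymx.
have UU : U *m U ^t* = 1%:M by apply/unitarymxP.
have UU' : U ^t* *m U = 1%:M by rewrite (mulmx1C UU).
have HE : H = U ^t* *m diag_mx (spectral_diag H) *m U.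
  rewrite -invmx_unitary//; apply/orthomx_spectralP/normalmxP.
  by rewrite /H trmxC_mul trmxCK.
exists #|I1|; split.
  apply: leq_trans (count_gt_nth_sort [seq sv i | i <- enum 'I_n] r).
  rewrite count_map cardE {1}/enum_mem size_filter enumT.
  apply/eq_leq/eq_count => i.
  by rewrite -[LHS]/(i \in I1) inE /singular_value /singular_values enumT.
exists (rowsub (fun k : 'I_#|I1| => enum_val k) U); split.
  apply/matrixP => a b; have := congr1 (fun M : 'M[R[i]]_n => M (enum_val a) (enum_val b)) UU.
  rewrite !mxE (inj_eq enum_val_inj) => <-.
  by apply: eq_bigr => j _; rewrite !mxE.
move=> v Ev.
have w0 i : i \in I1 -> (U *m v) i 0 = 0.
  move=> iI; have := congr1 (fun M : 'cV[R[i]]_(#|I1|) => M (enum_rank_in iI i) 0) Ev.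
  rewrite [in RHS]mxE => <-; rewrite !mxE.
  by apply: eq_bigr => j _; rewrite mxE enum_rankK_in.
have s0 := singular_value_ge0 A r.+1.
have -> : cnrm2 (A *m v) = cdot (U *m v) (diag_mx (spectral_diag H) *m (U *m v)).
  rewrite [RHS]cdotC [RHS]cdot_adj /cnrm2 [LHS]cdot_adj; congr cdot.
  by rewrite !mulmxA -HE.
rewrite -(cnrm2_isometry v UU'); move: (U *m v) w0 => w w0.
rewrite /cnrm2 !cdotE mulr_sumr; apply: ler_sum => i _.
have [iI|iNI] := boolP (i \in I1).
  by rewrite (w0 i iI) /= !mul0r !addr0 mulr0.
have li : complex.Re (spectral_diag H 0 i) <= singular_value A r.+1 ^+ 2.
  have [l0|l0] := leP 0 (complex.Re (spectral_diag H 0 i)); last first.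
    by rewrite (le_trans (ltW l0))// sqr_ge0.
  rewrite -[leLHS]sqr_sqrtr// lerXn2r ?nnegrE ?sqrtr_ge0//.
  by move: iNI; rewrite inE -leNgt.
rewrite mul_diag_mx mxE; move: li.
(* The terms in [l'] cancel in the real inner product. *)
case: (spectral_diag H 0 i) => l l'; case: (w i 0) => a b /= li.
apply: (@le_trans _ _ (l * (a * a + b * b))); last first.
  by rewrite ler_wpM2r// -!expr2 addr_ge0 ?sqr_ge0.
lra.
Qed.

(** * Cauchy-Schwarz inequality and the spectral norm *)

Lemma cauchy_schwarz_sum (F : realFieldType) (I : finType) (a b : I -> F) :
  (\sum_i a i * b i) ^+ 2 <= (\sum_i a i ^+ 2) * \sum_i b i ^+ 2.
Proof.
set N := \sum_i a i ^+ 2; set X := \sum_i b i ^+ 2; set s := \sum_i a i * b i.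
(* The right-hand side is the sum of the squares of N b_i - s a_i. *)
have h : 0 <= N * (N * X - s ^+ 2).
  have : 0 <= \sum_i (N * b i - s * a i) ^+ 2 by apply: sumr_ge0 => i _; exact: sqr_ge0.
  rewrite (eq_bigr (fun i =>
    N ^+ 2 * b i ^+ 2 + (- (2 * N * s)) * (a i * b i) + s ^+ 2 * a i ^+ 2)).
    by rewrite !big_split /= -!mulr_sumr -/N -/X -/s; lra.
  by move=> i _; ring.
have N0 : 0 <= N by apply: sumr_ge0 => i _; exact: sqr_ge0.
have [Nz|NNz] := eqVneq N 0; last by move: h; rewrite pmulr_rge0 ?subr_ge0// lt0r NNz.
suff -> : s = 0 by rewrite expr0n Nz mul0r.
apply: big1 => i _; move/eqP: Nz.
rewrite psumr_eq0 => [/allP/(_ i (mem_index_enum i))|j _]; last exact: sqr_ge0.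
by rewrite /= sqrf_eq0 => /eqP ->; rewrite mul0r.
Qed.

Lemma cdot_le_cvnorm (R : realType) n (x y : 'cV[R[i]]_n) : cdot x y <= cvnorm x * cvnorm y.
Proof.
rewrite (le_trans (ler_norm _))// -ler_sqr ?nnegrE ?mulr_ge0 ?cvnorm_ge0//.
rewrite (real_normK (num_real _)) exprMn !sqr_cvnorm /cnrm2 !cdotE.
pose p (z : 'cV[R[i]]_n) i (b : bool) := if b then complex.Re (z i 0) else complex.Im (z i 0).
have pE (z z' : 'cV[R[i]]_n) :
    \sum_i (complex.Re (z i 0) * complex.Re (z' i 0) +
            complex.Im (z i 0) * complex.Im (z' i 0))
    = \sum_(ib : 'I_n * bool) p z ib.1 ib.2 * p z' ib.1 ib.2.
  rewrite -(pair_bigA _ (fun i b => p z i b * p z' i b)) /=.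
  by apply: eq_bigr => i _; rewrite big_bool.
by rewrite !pE; apply: (le_trans (cauchy_schwarz_sum _ _)).
Qed.

Lemma cvnormD (R : realType) n (x y : 'cV[R[i]]_n) : cvnorm (x + y) <= cvnorm x + cvnorm y.
Proof.
rewrite -ler_sqr ?nnegrE ?addr_ge0 ?cvnorm_ge0//.
by rewrite sqr_cvnorm cnrm2D sqrrD !sqr_cvnorm; have := cdot_le_cvnorm x y; lra.
Qed.

Lemma cvnormN (R : realType) n (x : 'cV[R[i]]_n) : cvnorm (- x) = cvnorm x.
Proof. by rewrite !cvnormE cnrm2N. Qed.

Lemma cvnormZ (R : realType) n c (x : 'cV[R[i]]_n) : 0 <= c -> cvnorm (c%:C *: x) = c * cvnorm x.
Proof. by move=> c0; rewrite !cvnormE cnrm2Z sqrtrM ?sqr_ge0// sqrtr_sqr ger0_norm. Qed.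

Lemma cvnorm0 (R : realType) n : cvnorm (0 : 'cV[R[i]]_n) = 0.
Proof. by rewrite cvnormE /cnrm2 /cdot mulmx0 mxE sqrtr0. Qed.

Lemma cvnorm_le (R : realType) n k (x : 'cV[R[i]]_n) (y : 'cV[R[i]]_k) c : 0 <= c ->
  (cvnorm x <= c * cvnorm y) = (cnrm2 x <= c ^+ 2 * cnrm2 y).
Proof.
by move=> c0; rewrite -ler_sqr ?nnegrE ?mulr_ge0 ?cvnorm_ge0// exprMn !sqr_cvnorm.
Qed.

(** In [singular_tail] at rank 0 the matrix [E] has no rows, so the bound by the largest singular
    value holds for every vector. *)
Lemma bounded_mulmx (R : realType) m n (M : 'M[R[i]]_(m, n)) :
  exists2 K : R, 0 <= K & forall x, cvnorm (M *m x) <= K * cvnorm x.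
Proof.
have [q [q0 [E [_ ME]]]] := singular_tail M 0.
exists `|singular_value M 1|; first exact: normr_ge0.
move=> x; rewrite cvnorm_le ?normr_ge0// (real_normK (num_real _)); apply: ME.
by move: E; move: q0; rewrite leqn0 => /eqP -> E; apply/colP => -[].
Qed.

Lemma spectral_norm_leP (R : realType) m n (M : 'M[R[i]]_(m, n)) (c : R) : 0 <= c ->
  spectral_norm M <= c <-> forall x, cvnorm (M *m x) <= c * cvnorm x.
Proof.
move=> c0; rewrite /spectral_norm; set S := (X in sup X).
have S0 : S !=set0 by exists (cvnorm (M *m 0)); exists 0 => //=; rewrite cvnorm0.
split => [Mc x|Mc]; last first.
  apply: ge_sup => // _ [x /= x1 <-]; rewrite (le_trans (Mc x))//.
  by rewrite ler_piMr.
(* The supremum dominates the set only once the set is known to be bounded. *)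
have [K K0 MK] := bounded_mulmx M.
have Sub : has_ubound S.
  by exists K => _ [t /= t1 <-]; rewrite (le_trans (MK t))// ler_piMr.
have [x0|xN0] := eqVneq (cvnorm x) 0.
  by rewrite (le_trans (MK x))// x0 !mulr0.
have xp : 0 < cvnorm x by rewrite lt0r xN0 cvnorm_ge0.
pose y := ((cvnorm x)^-1)%:C *: x.
have xi : 0 <= (cvnorm x)^-1 by rewrite invr_ge0 ltW.
rewrite -ler_pdivrMr// mulrC -cvnormZ// scalemxAr (le_trans _ Mc)//.
apply: (ub_le_sup Sub); exists y => //=.
by rewrite cvnormZ// mulVf.
Qed.

(** * Residual of the orthogonal projector *)

(** As the projector fixes the range of [Y], subtracting Y z from A x leaves the residual unchanged,
    and the complementary projector is a contraction. *)
Lemma orthproj_residual (R : realType) m n d (A : 'M[R[i]]_(m, n)) (Y : 'M[R[i]]_(m, d)) x z :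
  cvnorm ((1%:M - orthproj Y) *m A *m x) <= cvnorm (A *m x - Y *m z).
Proof.
have [Y1 Y2 Y3 _] := pinvP Y; rewrite -/(orthproj Y) in Y1 Y3.
set Q := orthproj Y in Y1 Y3 *.
have QQ : Q *m Q = Q by rewrite {2}/Q /orthproj mulmxA Y1.
set u := A *m x - Y *m z.
have -> : (1%:M - Q) *m A *m x = u - Q *m u.
  rewrite /u mulmxBr (mulmxA Q Y) Y1 opprB addrA subrK.
  by rewrite !mulmxBl mul1mx mulmxA.
rewrite -[leRHS]mul1r cvnorm_le// expr1n mul1r cnrm2B.
have -> : cdot u (Q *m u) = cnrm2 (Q *m u).
  by rewrite /cnrm2 [RHS]cdot_adj Y3 mulmxA QQ cdotC.
by have := cnrm2_ge0 (Q *m u); lra.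
Qed.

Lemma orthproj_residual_attained (R : realType) m n d
    (A : 'M[R[i]]_(m, n)) (Y : 'M[R[i]]_(m, d)) (x : 'cV[R[i]]_n) :
  (1%:M - orthproj Y) *m A *m x = A *m x - Y *m (Defs.pinv Y *m A *m x).
Proof. by rewrite !mulmxBl mul1mx /orthproj !mulmxA. Qed.

(** * Frobenius bound and real matrices acting on complex vectors *)

(** The factor is the squared Frobenius norm, written through the images of the basis vectors under
    M^T, where the JL property gives bounds. *)
Lemma nrm2_mulmx_le (F : realFieldType) n d (M : 'M[F]_(n, d)) z :
  nrm2 (M *m z) <= (\sum_i nrm2 (M^T *m delta_mx i (0 : 'I_1))) * nrm2 z.
Proof.
rewrite mulr_suml; apply: ler_sum => i _; rewrite mxE.
apply: (le_trans (cauchy_schwarz_sum _ _)); rewrite ler_wpM2r ?nrm2_ge0//.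
rewrite le_eqVlt; apply/orP; left; apply/eqP.
by apply: eq_bigr => j _; rewrite -colE !mxE.
Qed.

Lemma Re_mulmx (R : realType) m n p (M : 'M[R[i]]_(m, n)) (X : 'M[R[i]]_(n, p)) :
  map_mx (@complex.Re R) (M *m X) =
  map_mx (@complex.Re R) M *m map_mx (@complex.Re R) X -
  map_mx (@complex.Im R) M *m map_mx (@complex.Im R) X.
Proof.
apply/matrixP => i j; rewrite !mxE Re_sum -sumrB; apply: eq_bigr => k _.
by rewrite !mxE; case: (M i k) (X k j) => a b [c e].
Qed.

Lemma Im_sum (R : realType) I (r : seq I) (f : I -> R[i]) :
  complex.Im (\sum_(i <- r) f i) = \sum_(i <- r) complex.Im (f i).
Proof. by rewrite (big_morph _ (fun x y => raddfD _ x y) (raddf0 _)). Qed.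

Lemma Im_mulmx (R : realType) m n p (M : 'M[R[i]]_(m, n)) (X : 'M[R[i]]_(n, p)) :
  map_mx (@complex.Im R) (M *m X) =
  map_mx (@complex.Re R) M *m map_mx (@complex.Im R) X +
  map_mx (@complex.Im R) M *m map_mx (@complex.Re R) X.
Proof.
apply/matrixP => i j; rewrite !mxE Im_sum -big_split; apply: eq_bigr => k _.
by rewrite !mxE; case: (M i k) (X k j) => a b [c e].
Qed.

Lemma cnrm2_real_mulmx (R : realType) m n (S : 'M[R]_(m, n)) x :
  cnrm2 (map_mx (real_complex R) S *m x) =
  nrm2 (S *m map_mx (@complex.Re R) x) + nrm2 (S *m map_mx (@complex.Im R) x).
Proof.
have ReS : map_mx (@complex.Re R) (map_mx (real_complex R) S) = S.
  by apply/matrixP => i j; rewrite !mxE.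
have ImS : map_mx (@complex.Im R) (map_mx (real_complex R) S) = 0.
  by apply/matrixP => i j; rewrite !mxE.
by rewrite cnrm2_parts Re_mulmx Im_mulmx ReS ImS !mul0mx subr0 addr0.
Qed.

Lemma real_trmxC (R : realType) m n (S : 'M[R]_(m, n)) :
  (map_mx (real_complex R) S) ^t* = map_mx (real_complex R) S^T.
Proof. by apply/matrixP => i j; rewrite !mxE; exact: conjc_real. Qed.

(** * Subspace embedding from finitely many test vectors *)

Definition preserves_nrm2 (R : realType) n d (e : R) (S : 'M[R]_(d, n)) (x : 'cV[R]_n) :=
  `|nrm2 (S *m x) - nrm2 x| <= e * nrm2 x.

(** The test vectors are fixed before [S], as a union bound requires. A vector of the range of [X]
    is B y with |y| = |B y|, so [net_lower_bound] loses only the factor 1 - 9 e. *)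
Lemma subspace_embedding (R : realType) n d k (X : 'M[R]_(n, k)) (e : R) :
  0 <= e ->
  exists2 xs : seq 'cV[R]_n, (size xs <= 5 ^ k)%N &
    forall S : 'M[R]_(d, n), (forall x, x \in xs -> preserves_nrm2 e S x) ->
    forall a, (1 - 9 * e) * nrm2 (X *m a) <= nrm2 (S *m (X *m a)).
Proof.
move=> e0; have [B [B1 B2]] := orthonormalize X.
exists [seq B *m grid_vec R f | f <- enum (grid_points k k.+2)].
  by rewrite size_map -cardE card_grid_points.
move=> S HS a.
have := @net_lower_bound _ _ _ _ B S e (B^T *m (X *m a)) e0
  (fun z => partial_isometry_contract z B1).
have BBX : B *m (B^T *m (X *m a)) = X *m a by rewrite !mulmxA B2.
rewrite BBX.
have -> : nrm2 (B^T *m (X *m a)) = nrm2 (X *m a).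
  by rewrite !nrm2_mx trmx_mul trmxK -mulmxA BBX.
move=> H; rewrite mulrBl mul1r; apply: H => f fg.
by apply: HS; apply: map_f; rewrite mem_enum.
Qed.

(** The real and imaginary parts of F u both lie in the real span of the 2 q columns of Re F and Im
    F. *)
Lemma complex_subspace_embedding (R : realType) n d q (F : 'M[R[i]]_(n, q)) (e : R) :
  0 <= e ->
  exists2 xs : seq 'cV[R]_n, (size xs <= 5 ^ (2 * q))%N &
    forall S : 'M[R]_(d, n), (forall x, x \in xs -> preserves_nrm2 e S x) ->
    forall u, (1 - 9 * e) * cnrm2 (F *m u) <= cnrm2 (map_mx (real_complex R) S *m (F *m u)).
Proof.
move=> e0; pose X := row_mx (map_mx (@complex.Re R) F) (map_mx (@complex.Im R) F).
have [xs sxs H] := subspace_embedding d X e0.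
exists xs; first by rewrite mul2n -addnn.
move=> S /H HS u; rewrite cnrm2_real_mulmx cnrm2_parts mulrDr.
have -> : map_mx (@complex.Re R) (F *m u) =
    X *m col_mx (map_mx (@complex.Re R) u) (- map_mx (@complex.Im R) u).
  by rewrite Re_mulmx mul_row_col mulmxN.
have -> : map_mx (@complex.Im R) (F *m u) =
    X *m col_mx (map_mx (@complex.Im R) u) (map_mx (@complex.Re R) u).
  by rewrite Im_mulmx mul_row_col.
exact: lerD.
Qed.

Lemma sketch_residual_of_JL (R : realType) m n r d (A : 'M[R[i]]_(m, n)) (eps : R) :
  (0 < n)%N -> 0 < eps < 1 ->
  exists2 xs : seq 'cV[R]_n, (size xs <= 5 ^ (2 * r) + n)%N &
    forall W : 'M[R]_(n, d),
      (forall x, x \in xs -> preserves_nrm2 (eps / 12) W^T x) ->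
      forall x, exists z, cvnorm (A *m x - A *m map_mx (real_complex R) W *m z) <=
        Num.sqrt (1 + n%:R * (1 + eps) / (1 - eps)) * singular_value A r.+1 * cvnorm x.
Proof.
move=> n0 /andP[eps0 eps1]; set e := eps / 12.
have n0' : 0 < n%:R :> R by rewrite ltr0n.
have e0 : 0 < e by rewrite divr_gt0.
have eE : eps = 12 * e by rewrite /e; lra.
have [q [qr [E [EE tail]]]] := singular_tail A r.
have [xs sxs H] := complex_subspace_embedding d (E ^t*) (ltW e0).
exists (xs ++ [seq delta_mx i 0 | i <- enum 'I_n]).
  rewrite size_cat size_map size_enum_ord leq_add2r (leq_trans sxs)//.
  by rewrite leq_exp2l// leq_mul2l qr orbT.
move=> W JL x.
have C0 : 0 <= 1 + n%:R * (1 + eps) / (1 - eps).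
  by rewrite addr_ge0// divr_ge0 ?mulr_ge0//; lra.
have s0 : 0 < 1 - 9 * e by lra.
have rho0 : 0 < n%:R * (1 + e) by rewrite mulr_gt0//; lra.
have sg0 := singular_value_ge0 A r.+1.
have low u : (1 - 9 * e) * cnrm2 u <=
    cnrm2 ((map_mx (real_complex R) W) ^t* *m (E ^t* *m u)).
  rewrite real_trmxC -(cnrm2_isometry u (M := E ^t*)) ?trmxCK//.
  by apply: H => y yxs; apply: JL; rewrite mem_cat yxs.
have up z : cnrm2 (map_mx (real_complex R) W *m z) <= n%:R * (1 + e) * cnrm2 z.
  rewrite cnrm2_real_mulmx cnrm2_parts mulrDr.
  have WF y : nrm2 (W *m y) <= n%:R * (1 + e) * nrm2 y.
    apply: (le_trans (nrm2_mulmx_le _ _)); rewrite ler_wpM2r ?nrm2_ge0//.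
    apply: (@le_trans _ _ (\sum_(i < n) (1 + e))); last by rewrite sumr_const card_ord mulr_natl.
    apply: ler_sum => i _.
    have : preserves_nrm2 e W^T (delta_mx i 0).
      apply: JL; rewrite mem_cat; apply/orP; right.
      by apply: (map_f (fun i => delta_mx i 0)); rewrite mem_enum.
    by rewrite /preserves_nrm2 nrm2_delta ler_norml => /andP[_]; lra.
  exact: lerD.
have [z zP] := sketch_residual EE (sqr_ge0 _) s0 rho0 tail low up x.
exists z; rewrite cvnorm_le ?mulr_ge0 ?sqrtr_ge0//.
apply: (le_trans zP); rewrite exprMn sqr_sqrtr//.
rewrite ler_wpM2r ?cnrm2_ge0// ler_wpM2r ?sqr_ge0//.
(* What remains is (1 + e) / (1 - 9 e) <= (1 + eps) / (1 - eps) with eps = 12 e. *)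
rewrite lerD2l ler_pdivrMr// -mulrA -!mulrA ler_pM2l//.
rewrite mulrCA mulrC -ler_pdivrMr; last by rewrite invr_gt0; lra.
by rewrite invrK eE; nra.
Qed.

(** * Rational approximation and measurability *)

Definition ratc (R : realType) n (x : 'cV[rat * rat]_n) : 'cV[R[i]]_n :=
  map_mx (fun p => (ratr p.1 +i* ratr p.2)%C) x.

Lemma ratc_dense (R : realType) n (x : 'cV[R[i]]_n) (e : R) :
  0 < e -> exists q, cvnorm (x - ratc R q) <= e.
Proof.
(* An error h in each of the 2 n real coordinates gives 2 n h^2 <= (n + 1)^2 h^2 = e^2. *)
move=> e0; pose h := e / n.+1%:R; have h0 : 0 < h by rewrite divr_gt0.
have appr (y : R) : {q : rat | (y - ratr q) ^+ 2 <= h ^+ 2}.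
  apply: cid; have [|q] := @rat_in_itvoo _ (y - h) (y + h); first by lra.
  rewrite in_itv /= => /andP[q1 q2]; exists q.
  by rewrite -[leLHS](real_normK (num_real _)) lerXn2r ?nnegrE ?(ltW h0)// ler_norml; lra.
exists (\col_i (projT1 (appr (complex.Re (x i 0))), projT1 (appr (complex.Im (x i 0))))).
rewrite -ler_sqr ?nnegrE ?cvnorm_ge0 ?(ltW e0)// sqr_cvnorm /cnrm2 cdotE.
apply: (@le_trans _ _ (\sum_(i < n) 2 * h ^+ 2)).
  apply: ler_sum => i _; rewrite !mxE.
  have := projT2 (appr (complex.Re (x i 0))); have := projT2 (appr (complex.Im (x i 0))).
  set p := projT1 _; set q := projT1 _; case: (x i 0) => a b /=; lra.
have -> : e = (n%:R + 1) * h by rewrite natr1 /h mulrC divfK.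
rewrite sumr_const card_ord -(mulr_natl (2 * h ^+ 2) n) -subr_ge0.
have -> : ((n%:R + 1) * h) ^+ 2 - n%:R * (2 * h ^+ 2) = (n%:R ^+ 2 + 1) * h ^+ 2 by ring.
by rewrite mulr_ge0 ?addr_ge0 ?sqr_ge0.
Qed.

Lemma spectral_norm_residual_le (R : realType) m n d (A : 'M[R[i]]_(m, n))
    (Y : 'M[R[i]]_(m, d)) (c : R) :
  0 <= c -> (forall x, exists z, cvnorm (A *m x - Y *m z) <= c * cvnorm x) ->
  spectral_norm ((1%:M - orthproj Y) *m A) <= c.
Proof.
move=> c0 H; apply/(spectral_norm_leP _ c0) => x; have [z] := H x.
exact/le_trans/orthproj_residual.
Qed.

(* Rational test vectors make the event a countable combination of sets that
   are visibly measurable, whereas [pinv] is not even continuous. *)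
Lemma spectral_norm_residual_ratP (R : realType) m n d (A : 'M[R[i]]_(m, n))
    (Y : 'M[R[i]]_(m, d)) (c : R) : 0 <= c ->
  spectral_norm ((1%:M - orthproj Y) *m A) <= c <->
  forall x N, exists z,
    cvnorm (A *m ratc R x - Y *m ratc R z) <= c * cvnorm (ratc R x) + N.+1%:R^-1.
Proof.
move=> c0; split=> [/(spectral_norm_leP _ c0) H x N|H].
  have [K K0 YK] := bounded_mulmx Y.
  pose z0 := Defs.pinv Y *m A *m ratc R x.
  have N0 : 0 < N.+1%:R^-1 :> R by rewrite invr_gt0.
  (* The tolerance is divided by K + 1 since [Y] stretches the error by at most [K]. *)
  have [z zP] := ratc_dense z0 (divr_gt0 N0 (ltr_wpDl K0 ltr01)).
  exists z.
  have -> : A *m ratc R x - Y *m ratc R z = (A *m ratc R x - Y *m z0) + Y *m (z0 - ratc R z).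
    by rewrite mulmxBr addrA subrK.
  rewrite (le_trans (cvnormD _ _))// lerD//.
    by rewrite -orthproj_residual_attained.
  rewrite (le_trans (YK _))// (le_trans (ler_wpM2l K0 zP))//.
  by rewrite mulrCA ler_piMr ?(ltW N0)// ler_pdivrMr ?ltr_wpDl// mul1r lerDl.
apply/(spectral_norm_leP _ c0) => x; set M := _ *m A.
have [K K0 MK] := bounded_mulmx M.
apply/ler_addgt0Pr => /= e e0.
have k0 : 0 < K + c + 1 by lra.
(* Replacing x by q costs at most (K + c) |x - q| <= e / 2; the other half of [e] absorbs 1 / (N +
   1). *)
have [q qP] := ratc_dense x (divr_gt0 (divr_gt0 e0 (ltr0Sn _ 1)) k0).
have [N NP] : exists N : nat, N.+1%:R^-1 <= e / 2.
  exists (Num.truncn (e / 2)^-1); rewrite invf_ple ?posrE ?divr_gt0//.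
  by rewrite ltW// truncnS_gt.
have [z zP] := H q N.
have -> : M *m x = M *m ratc R q + M *m (x - ratc R q) by rewrite mulmxBr addrC subrK.
rewrite (le_trans (cvnormD _ _))//.
have h1 := le_trans (orthproj_residual A Y (ratc R q) (ratc R z)) zP.
rewrite -/M in h1.
have h2 := MK (x - ratc R q).
have h3 : cvnorm (ratc R q) <= cvnorm x + cvnorm (x - ratc R q).
  rewrite -(cvnormN (x - _)) (le_trans _ (cvnormD _ _))//.
  by rewrite opprB addrC subrK.
have h4 := ler_wpM2l c0 h3.
have h5 : (K + c) * cvnorm (x - ratc R q) <= e / 2.
  move: qP; rewrite ler_pdivlMr// => qP; apply: le_trans qP.
  rewrite mulrC ler_wpM2l ?cvnorm_ge0//.
  by rewrite lerDl ler01.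
move: h1 h2 h4 h5 NP; clear; rewrite mulrDr mulrDl.
move: (N.+1%:R^-1) => iN.
set a := cvnorm (M *m ratc R q); set b := cvnorm (M *m _); set t := cvnorm (x - _).
set u := cvnorm (ratc R q); set v := cvnorm x.
lra.
Qed.

Lemma measurable_residual (R : realType) (dT : measure_display) (T : measurableType dT)
    m n d (A : 'M[R[i]]_(m, n)) (W : T -> 'M[R]_(n, d)) x z :
  random_matrix W ->
  measurable_fun [set: T] (fun w => cnrm2 (A *m x - A *m map_mx (real_complex R) (W w) *m z)).
Proof.
move=> mW; rewrite /cnrm2.
have E w i : (A *m x - A *m map_mx (real_complex R) (W w) *m z) i 0 =
   (A *m x) i 0 - \sum_k \sum_j ((W w j k)%:C * (A i j * z k 0)).
  rewrite !mxE; congr (_ - _); apply: eq_bigr => k _.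
  rewrite !mxE mulr_suml; apply: eq_bigr => j _; rewrite !mxE.
  by rewrite mulrA [X in X * _]mulrC.
(* The residual is affine in the entries of [W]; an abstract real-linear [f] treats Re and Im at
   once. *)
have lin (f : R[i] -> R) (fD : {morph f : a b / a + b}) (f0 : f 0 = 0)
    (fN : {morph f : a / - a})
    (fZ : forall r a, f (r%:C * a) = r * f a) i :
    measurable_fun [set: T] (fun w => f ((A *m x - A *m map_mx (real_complex R) (W w) *m z) i 0)).
  under eq_fun => w do rewrite E fD fN (big_morph f fD f0).
  apply: measurable_funB; first exact: measurable_cst.
  apply: measurable_sum => k.
  under eq_fun => w do rewrite (big_morph f fD f0).
  apply: measurable_sum => j; under eq_fun => w do rewrite fZ.
  by apply: measurable_funM; [exact: mW | exact: measurable_cst].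
have mRe i := lin (@complex.Re R) (fun x y => raddfD _ x y) (raddf0 _) (fun x => raddfN _ x)
  (fun r a => ltac:(by case: a => a b /=; ring)) i.
have mIm i := lin (@complex.Im R) (fun x y => raddfD _ x y) (raddf0 _) (fun x => raddfN _ x)
  (fun r a => ltac:(by case: a => a b /=; ring)) i.
under eq_fun => w do rewrite cdotE.
apply: measurable_sum => i; apply: measurable_funD; exact: measurable_funM.
Qed.

Lemma measurable_spectral_norm_le (R : realType) (dT : measure_display) (T : measurableType dT)
    m n d (A : 'M[R[i]]_(m, n)) (W : T -> 'M[R]_(n, d)) (c : R) :
  random_matrix W -> 0 <= c ->
  measurable [set w | spectral_norm
    ((1%:M - orthproj (A *m map_mx (real_complex R) (W w))) *m A) <= c].
Proof.
move=> mW c0.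
(* For all N and x there is a z: the quantifier over x becomes the complement of a countable union
   of complements, and squaring replaces [cvnorm] by a polynomial. *)
rewrite (_ : [set w | _] =
  \bigcap_(N : nat) ~` \bigcup_(x : 'cV[rat * rat]_n) ~` \bigcup_(z : 'cV[rat * rat]_d)
   [set w | cnrm2 (A *m ratc R x - A *m map_mx (real_complex R) (W w) *m ratc R z) <=
     (c * cvnorm (ratc R x) + N.+1%:R^-1) ^+ 2]); last first.
  apply/seteqP; split=> w /=.
    move=> /(spectral_norm_residual_ratP _ _ c0) H N _ [x _]; apply.
    have [z zP] := H x N; exists z => //=.
    by rewrite -sqr_cvnorm lerXn2r// nnegrE ?cvnorm_ge0// addr_ge0// mulr_ge0// cvnorm_ge0.
  move=> H; apply/(spectral_norm_residual_ratP _ _ c0) => x N.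
  apply: contrapT => nz; apply: (H N I); exists x => // -[z _ /= zP].
  apply: nz; exists z; move: zP.
  by rewrite -sqr_cvnorm ler_sqr// nnegrE ?cvnorm_ge0// addr_ge0// mulr_ge0// cvnorm_ge0.
apply: bigcapT_measurable => N; apply: measurableC.
apply: countable_bigcupT_measurable => [|x]; first exact: countableP.
apply: measurableC; apply: countable_bigcupT_measurable => [|z]; first exact: countableP.
rewrite -[X in measurable X]setTI; apply: measurable_fun_le => //.
exact: measurable_residual.
Qed.

Lemma measurable_distortion (R : realType) (dT : measure_display) (T : measurableType dT)
    n d (S : T -> 'M[R]_(d, n)) (e : R) x :
  random_matrix S -> measurable [set w | preserves_nrm2 e (S w) x].
Proof.
move=> mS; rewrite -[X in measurable X]setTI.
apply: measurable_fun_le => //; apply: measurableT_comp => //.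
apply: measurable_funB; last exact: measurable_cst.
apply: measurable_sum => i; apply: measurable_funX.
under eq_fun => w do rewrite mxE.
by apply: measurable_sum => j; apply: measurable_funM; [exact: mS | exact: measurable_cst].
Qed.

(** * Union bound and the probability estimate *)

Lemma union_bound (R : realType) (dT : measure_display) (T : measurableType dT)
    (P : probability T R) (I : eqType) (s : seq I) (G : I -> set T) (c : R) :
  (forall i, measurable (G i)) -> (forall i, P (~` G i) <= c%:E)%E ->
  measurable [set w | forall i, i \in s -> G i w] /\
  ((1 - (size s)%:R * c)%:E <= P [set w | forall i, i \in s -> G i w])%E.
Proof.
move=> mG Pc.
have [mB PB] : measurable [set w | forall i, i \in s -> G i w] /\
    (P (~` [set w | forall i, i \in s -> G i w]) <= ((size s)%:R * c)%:E)%E.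
  elim: s => [|x s [mB PB]].
    rewrite (_ : [set w | _] = setT) ?setCT ?measure0 ?mul0r//.
    by apply/seteqP; split.
  rewrite (_ : [set w | _] = G x `&` [set w | forall i, i \in s -> G i w]); last first.
    apply/seteqP; split => w /=.
      by move=> H; split => [|i is_]; apply: H; rewrite inE ?eqxx ?is_ ?orbT.
    by move=> [Gx H] i; rewrite inE => /predU1P[->//|]; exact: H.
  split; first exact: measurableI.
  rewrite setCI; apply: le_trans (measureU2 _ _ _) _; try exact: measurableC.
  by rewrite /= -natr1 mulrDl mul1r EFinD addrC leeD.
split=> //; rewrite -[X in P X]setCK probability_setC; last exact: measurableC.
by rewrite EFinB leeB.
Qed.

Theorem theorem5 (R : realType) (dT : measure_display) (T : measurableType dT)
    (P : probability T R)
    (m n r p d : nat) (A : 'M[R[i]]_(m, n)) (eps delta : R)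
    (Rm : T -> 'M[R]_(n, d)) :
  (0 < r < minn m n)%N ->
  0 < eps < 1 ->
  0 < delta < 1 ->
  d = (r + p)%N ->
  JL_sketching_right P (delta / (2 * (maxn (5 ^ (2 * r)) n)%:R)) (eps / 12) Rm ->
  ((1 - delta)%:E <=
    P [set w | spectral_norm
                 ((1%:M - orthproj (A *m map_mx (real_complex R) (Rm w))) *m A)
               <= Num.sqrt (1 + n%:R * (1 + eps) / (1 - eps))
                  * singular_value A r.+1]%R)%E.
Proof.
move=> /andP[_ rmn] epsb /andP[delta0 _] _ [mS JL].
have n0 : (0 < n)%N by lia.
have mW : random_matrix Rm by move=> i j; have := mS j i; under eq_fun do rewrite mxE.
have [xs sxs Hxs] := sketch_residual_of_JL r d A n0 epsb.
have c0 : 0 <= Num.sqrt (1 + n%:R * (1 + eps) / (1 - eps)) * singular_value A r.+1.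
  by rewrite mulr_ge0 ?sqrtr_ge0 ?singular_value_ge0.
set M := maxn _ _ in JL; set c := delta / _ in JL.
have M0 : (0 < M)%N by rewrite leq_max expn_gt0.
have M0' : 0 < M%:R :> R by rewrite ltr0n.
have cp : 0 <= c by rewrite divr_ge0 ?mulr_ge0// ltW.
pose G x := [set w | preserves_nrm2 (eps / 12) (Rm w)^T x].
have mG x : measurable (G x) by exact: measurable_distortion.
have PG x : (P (~` G x) <= c%:E)%E.
  apply: ltW; rewrite (_ : ~` G x = [set w | `|vnorm ((Rm w)^T *m x) ^+ 2 - vnorm x ^+ 2|
     > eps / 12 * vnorm x ^+ 2]); first exact: JL.
  by apply/seteqP; split=> w /=; rewrite /G /= /preserves_nrm2 !nrm2_vnorm ltNge => /negP.
have [mE PE] := union_bound xs mG PG.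
apply: (@le_trans _ _ (P [set w | forall x, x \in xs -> G x w])).
  apply: le_trans PE; rewrite lee_fin lerD2l lerN2.
  (* The number of test vectors is at most 5^(2r) + n <= 2 M, each failing with probability at most
     [c]. *)
  have -> : delta = (2 * M%:R) * c by rewrite mulrC divfK// gt_eqF// mulr_gt0.
  rewrite ler_wpM2r// -natrM ler_nat (leq_trans sxs)// [leqRHS]mul2n -addnn.
  by rewrite leq_add ?leq_maxl ?leq_maxr.
apply: le_measure; rewrite ?inE//; first exact: measurable_spectral_norm_le.
move=> w /= HG; apply: spectral_norm_residual_le => // x; exact: Hxs.
Qed.
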